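(* The group $W=\langle A,\overline{A}\rangle$ of permutations of $P^*$ is a group of exponential growth, but not of uniformly exponential growth.
   Context: Let $P=\{1,2,3,4,5,6,7\}$ (the projective plane over $\mathbb{F}_2$). Permutations act on the right. Let $x=(1,5)(3,7)$, $y=(2,3)(6,7)$, $z=(4,6)(5,7)$ be permutations of $P$, and let $A=\langle x,y,z\rangle\cong \mathrm{PSL}(3,2)$, acting on $P$. Let $P^*$ be the set of finite sequences over $P$. The group $A$ acts on $P^*$ by $(p_1p_2\dots p_n)a=(p_1a)p_2\dots p_n$ (fixing the empty sequence). An isomorphic copy $\overline{A}=\{\overline a: a\in A\}$ of $A$ acts on $P^*$ by $$(p_1\dots p_mp_{m+1}\dots p_n)\overline a=p_1\dots p_m(p_{m+1}a)p_{m+2}\dots p_n\quad\text{whenever } p_1=\dots=p_{m-1}=1,\ p_m=2,$$ for some $m\ge 1$ with $m<n$, and $\overline a$ fixes all sequences not of this form. The group $W$ is the group of permutations of $P^*$ generated by $A$ and $\overline A$. For a group $G$ generated by a finite set $S$, let $B_{G,S}(n)$ be the ball of radius $n$ in $G$ for the word metric induced by $S$ (elements that are products of at most $n$ elements of $S\cup S^{-1}$), and let $\lambda(G,S)=\lim_{n\to\infty}\sqrt[n]{\#B_{G,S}(n)}$ (the limit exists). A finitely generated group $G$ has exponential growth if $\lambda(G,S)>1$ for one (equivalently, any) finite generating set $S$. It has uniformly exponential growth if $\inf_{S}\lambda(G,S)>1$, the infimum being over all finite generating sets $S$ of $G$. *)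

(* Defs.v *)
From HB Require Import structures.
From mathcomp Require Import all_boot all_order all_algebra all_fingroup.
From mathcomp Require Import finmap.
From mathcomp Require Import all_classical all_reals all_analysis.

Set Implicit Arguments.
Unset Strict Implicit.
Unset Printing Implicit Defensive.

Import Order.TTheory GRing.Theory Num.Theory.
Import numFieldNormedType.Exports.

Local Open Scope classical_set_scope.
Local Open Scope ring_scope.

Section SymmetricGroup.

(* The inverse is stored, so that no choice is needed to define the group law;
   as it is determined by the function, permutations that agree pointwise are
   equal, see [symP]. *)
Record sym (T : Type) := Sym {
  sym_fun :> T -> T;
  sym_inv : T -> T;
  sym_funK : cancel sym_fun sym_inv;
  sym_invK : cancel sym_inv sym_fun }.

Variable T : Type.
Implicit Types f g h : sym T.

Lemma symP f g : f =1 g -> f = g.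
Proof.
case: f g => [f f' fK f'K] [g g' gK g'K] /= fg.
have E : f = g by apply/funext.
move: fK f'K; rewrite E => fK f'K.
have E' : f' = g' by apply/funext => t; rewrite -{1}(g'K t) fK.
move: fK f'K; rewrite E' => fK f'K.
by congr Sym; apply/Prop_irrelevance.
Qed.

Definition sym1 : sym T := @Sym T id id (fun=> erefl) (fun=> erefl).

Definition symV f : sym T :=
  @Sym T (sym_inv f) f (@sym_invK _ f) (@sym_funK _ f).

(* Permutations act on the right: f comes first in the product [symM f g]. *)
Definition symM f g : sym T :=
  @Sym T (g \o f) (sym_inv f \o sym_inv g)
    (can_comp (@sym_funK _ g) (@sym_funK _ f))
    (can_comp (@sym_invK _ f) (@sym_invK _ g)).

HB.instance Definition _ := gen_eqMixin (sym T).
HB.instance Definition _ := gen_choiceMixin (sym T).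

Fact symMA : associative symM. Proof. by move=> f g h; exact: symP. Qed.
Fact sym1M : left_id sym1 symM. Proof. by move=> f; exact: symP. Qed.
Fact symM1 : right_id sym1 symM. Proof. by move=> f; exact: symP. Qed.
Fact symVM : left_inverse sym1 symV symM.
Proof. by move=> f; apply: symP => t /=; exact: sym_invK. Qed.
Fact symMV : right_inverse sym1 symV symM.
Proof. by move=> f; apply: symP => t /=; exact: sym_funK. Qed.

HB.instance Definition _ :=
  isGroup.Build (sym T) symMA sym1M symM1 symVM symMV.

End SymmetricGroup.

Section Growth.
Variable G : groupType.
Implicit Types (H S : set G) (n : nat).

Definition subgroup_generated S : set G :=
  smallest [set H : set G | group_closed (mem H)] S.

Definition finite_generating_set H S := finite_set S /\ subgroup_generated S = H.

Definition word_ball S n : set G :=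
  [set g | exists w : seq G,
     [/\ (size w <= n)%N, {in w, forall s, S s \/ S s^-1%g}
       & g = (\prod_(s <- w) s)%g]].

Lemma finite_word_ball S n : finite_set S -> finite_set (word_ball S n).
Proof.
move=> finS; elim: n => [|n IHn].
  apply: (@sub_finite_set _ _ [set 1%g]) (finite_set1 _) => g [w []].
  by rewrite leqn0 size_eq0 => /eqP -> _ ->; rewrite big_nil.
pose L := S `|` [set s^-1%g | s in S].
have finL : finite_set L by rewrite finite_setU; split=> //; exact: finite_image.
apply: (@sub_finite_set _ _
  ([set 1%g] `|` [set (p.1 * p.2)%g | p in L `*` word_ball S n])).
  move=> g [[|s w] [szw Sw ->]]; first by left; rewrite big_nil.
  right; exists (s, (\prod_(t <- w) t)%g); last by rewrite big_cons.
  split=> /=.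
    have [Ss|Ss] := Sw s (mem_head _ _); first by left.
    by right; exists s^-1%g => //; rewrite invgK.
  by exists w; split=> // t tw; apply: Sw; rewrite inE tw orbT.
by rewrite finite_setU; split=> //; apply/finite_image/finite_setX.
Qed.

Variable R : realType.

(* For n > 0, x `^ n%:R^-1 is the n-th root of x. The balls are finite, and their
   cardinals are submultiplicative in n, so the limit exists for finite S. *)
Definition growth_rate S : R :=
  lim ((fun n => #|` fset_set (word_ball S n)|%:R `^ n%:R^-1) @ \oo).

Definition exponential_growth H :=
  exists S, finite_generating_set H S /\ 1 < growth_rate S.

Definition uniformly_exponential_growth H : Prop :=
  1 < inf [set growth_rate S | S in finite_generating_set H].

End Growth.

(* The points 1, ..., 7 of the plane are the ordinals 0, ..., 6. *)
Notation plane := 'I_7.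

Definition pt1 : plane := @Ordinal 7 0 isT.
Definition pt2 : plane := @Ordinal 7 1 isT.
Definition pt3 : plane := @Ordinal 7 2 isT.
Definition pt4 : plane := @Ordinal 7 3 isT.
Definition pt5 : plane := @Ordinal 7 4 isT.
Definition pt6 : plane := @Ordinal 7 5 isT.
Definition pt7 : plane := @Ordinal 7 6 isT.

Definition gen_x : {perm plane} := (tperm pt1 pt5 * tperm pt3 pt7)%g.
Definition gen_y : {perm plane} := (tperm pt2 pt3 * tperm pt6 pt7)%g.
Definition gen_z : {perm plane} := (tperm pt4 pt6 * tperm pt5 pt7)%g.

Definition A : {group {perm plane}} := <<[set gen_x; gen_y; gen_z]%SET>>%G.

Definition head_act (a : {perm plane}) (s : seq plane) : seq plane :=
  if s is p :: s' then a p :: s' else [::].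

Fixpoint bar_act (a : {perm plane}) (s : seq plane) : seq plane :=
  if s is p :: s' then
    if p == pt1 then p :: bar_act a s'
    else if p == pt2 then p :: head_act a s'
    else s
  else [::].

Lemma bar_act_moves (a : {perm plane}) k p (s : seq plane) :
  bar_act a (nseq k pt1 ++ pt2 :: p :: s) = nseq k pt1 ++ pt2 :: a p :: s.
Proof. by elim: k => //= k ->. Qed.

Lemma bar_act_fixes (a : {perm plane}) (s : seq plane) :
  (forall k p s', s <> nseq k pt1 ++ pt2 :: p :: s') -> bar_act a s = s.
Proof.
elim: s => //= p s IHs Hs; case: eqP => [p1|_].
  congr cons; apply: IHs => k q s' E.
  by apply: (Hs k.+1 q s'); rewrite /= -E p1.
case: eqP => // p2; case: s Hs {IHs} => // q s Hs.
by case: (Hs 0%N q s); rewrite /= p2.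
Qed.

Fact head_actK (a : {perm plane}) : cancel (head_act a) (head_act a^-1%g).
Proof. by case=> //= p s; rewrite permK. Qed.

Fact head_actVK (a : {perm plane}) : cancel (head_act a^-1%g) (head_act a).
Proof. by case=> //= p s; rewrite permKV. Qed.

Fact bar_actK (a : {perm plane}) : cancel (bar_act a) (bar_act a^-1%g).
Proof.
elim=> //= p s IHs; case p1: (p == pt1); first by rewrite /= p1 IHs.
by case p2: (p == pt2); rewrite /= p1 p2 ?head_actK.
Qed.

Fact bar_actVK (a : {perm plane}) : cancel (bar_act a^-1%g) (bar_act a).
Proof. by move=> s; rewrite -{1}(invgK a) bar_actK. Qed.

Definition head_sym (a : {perm plane}) : sym (seq plane) :=
  Sym (head_actK a) (head_actVK a).

Definition bar_sym (a : {perm plane}) : sym (seq plane) :=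
  Sym (bar_actK a) (bar_actVK a).

Definition W : set (sym (seq plane)) :=
  subgroup_generated ([set head_sym a | a in [set` A]] `|`
             [set bar_sym a | a in [set` A]]).

(* Main.v *)
(* For a triple t = (t_x, t_y, t_z) of involutions generating W, the elements
   t_l' = <<..., t_l, ...>> l, with t_l at one point fixed by l, are again
   involutions, and they generate W again: (x'y')^4, (y'z')^4, (x'z')^4 are base
   elements supported on the complements of three lines which have only the
   point 7 in common, so iterated commutators of their conjugates fill the
   coordinate 7.

   Reading a word of length n in t' yields seven words in t of total length at
   most n. Except for factors of the periodic words (xyz)^oo and (zyx)^oo, short
   words already produce a square of an involution in some coordinate, which
   shortens the total length by 2. Hence a word of length n either is one of at
   most e^(tau n) words with few such cancellations, or its sections have total
   length at most (1 - 2 / q) n for some q depending on tau only. Iterating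
   t |-> t' therefore brings the growth exponent below any positive bound.

   For the exponential growth, let c_i be involutions of A exchanging 1 and 2.
   The product of the elements bar(c_i) d_i determines the sequence (c_i) when its
   length is a power of 2: the section at 1 is the product of the elements
   bar(c_i) c_(i+1), i odd, and the section at 2 is the inverse of a product of
   the same kind that has the c_i with i even at the barred places. *)

From HB Require Import structures.
From mathcomp Require Import all_boot all_order all_algebra all_fingroup.
From mathcomp Require Import finmap.
From mathcomp Require Import all_classical all_reals all_analysis.
From mathcomp Require Import ring lra zify.
Require Import Defs.

Set Implicit Arguments.
Unset Strict Implicit.
Unset Printing Implicit Defensive.

Import Order.TTheory GRing.Theory Num.Theory.
Import numFieldNormedType.Exports.

Local Open Scope classical_set_scope.
Local Open Scope group_scope.

(** * Subgroups and the wreath decomposition *)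

Section Subgroups.
Variable G : groupType.
Implicit Types (H S : set G) (g h : G).

Definition is_subgroup H := H 1 /\ forall g h, H g -> H h -> H (g * h^-1).

Lemma is_subgroupP H : is_subgroup H <-> group_closed (mem H).
Proof.
split=> -[H1 HB]; split.
- exact/mem_set.
- by move=> g h /set_mem Hg /set_mem Hh; apply/mem_set/HB.
- exact/set_mem.
- by move=> g h Hg Hh; apply/set_mem/HB; exact/mem_set.
Qed.

Lemma subgroupV H g : is_subgroup H -> H g -> H g^-1.
Proof. by move=> [H1 HB] Hg; rewrite -[g^-1]mul1g; exact: HB. Qed.

Lemma subgroupM H g h : is_subgroup H -> H g -> H h -> H (g * h).
Proof.
by move=> sH Hg Hh; rewrite -[h]invgK; apply: sH.2 => //; exact: subgroupV.
Qed.

Lemma subgroupJ H g h : is_subgroup H -> H g -> H h -> H (g ^ h).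
Proof.
move=> sH Hg Hh; rewrite conjgE; apply: subgroupM => //; first exact: subgroupV.
exact: subgroupM.
Qed.

Lemma subgroupR H g h : is_subgroup H -> H g -> H h -> H [~ g, h].
Proof.
move=> sH Hg Hh; rewrite commgEl; apply: subgroupM => //.
  exact: subgroupV.
exact: subgroupJ.
Qed.

Lemma subgroup_prod H I (w : seq I) (t : I -> G) :
  is_subgroup H -> (forall i, H (t i)) -> H (\prod_(i <- w) t i).
Proof.
move=> sH Ht; elim: w => [|i w IH]; first by rewrite big_nil; exact: sH.1.
by rewrite big_cons; exact: subgroupM.
Qed.

Lemma generated_is_subgroup S : is_subgroup (subgroup_generated S).
Proof.
split=> [H [/(is_subgroupP H).2 sH _]|g h Sg Sh H [sH SH]]; first exact: sH.1.
by apply: ((is_subgroupP H).2 sH).2; [exact: Sg|exact: Sh].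
Qed.

Lemma sub_generated S : S `<=` subgroup_generated S.
Proof. by move=> g Sg H [_]; exact. Qed.

Lemma generated_sub S H :
  is_subgroup H -> S `<=` H -> subgroup_generated S `<=` H.
Proof. by move=> sH SH g; apply; split => //; exact: (is_subgroupP H).1. Qed.

End Subgroups.

Section Decomposition.
Implicit Types (f g : plane -> sym (seq plane)) (s t : {perm plane}).

Definition dec_fun f s (w : seq plane) :=
  if w is p :: q then s p :: f p q else [::].

Definition dec_inv f s (w : seq plane) :=
  if w is p :: q then s^-1 p :: sym_inv (f (s^-1 p)) q else [::].

Fact dec_funK f s : cancel (dec_fun f s) (dec_inv f s).
Proof. by case=> //= p q; rewrite permK sym_funK. Qed.

Fact dec_invK f s : cancel (dec_inv f s) (dec_fun f s).
Proof. by case=> //= p q; rewrite permKV sym_invK. Qed.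

(* The element <<f 1, ..., f 7>> s of the permutational wreath product. *)
Definition dec f s : sym (seq plane) := Sym (dec_funK f s) (dec_invK f s).

Lemma decM f g s t :
  dec f s * dec g t = dec (fun p => f p * g (s p)) (s * t).
Proof. by apply: symP => -[|p q] //=; rewrite permM. Qed.

Lemma eq_dec f g s t : f =1 g -> s = t -> dec f s = dec g t.
Proof. by move=> fg ->; apply: symP => -[|p q] //=; rewrite fg. Qed.

Lemma dec1 f : f =1 (fun=> 1) -> dec f 1 = 1.
Proof. by move=> f1; apply: symP => -[|p q] //=; rewrite f1 perm1. Qed.

Lemma decV f s : (dec f s)^-1 = dec (fun p => (f (s^-1 p))^-1) s^-1.
Proof. by apply: symP => -[|p q]. Qed.

Lemma decV1 f : (dec f 1)^-1 = dec (fun p => (f p)^-1) 1.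
Proof. by rewrite decV; apply: eq_dec => [p|]; rewrite invg1 // perm1. Qed.

Lemma decM1 f g : dec f 1 * dec g 1 = dec (fun p => f p * g p) 1.
Proof. by rewrite decM; apply: eq_dec => [p|]; rewrite ?perm1 // mulg1. Qed.

Lemma decJ f g s :
  dec g 1 ^ dec f s = dec (fun p => g (s^-1 p) ^ f (s^-1 p)) 1.
Proof.
rewrite conjgE decV !decM mul1g mulVg; apply: eq_dec => // p.
by rewrite perm1 conjgE.
Qed.

Lemma decR f g : [~ dec f 1, dec g 1] = dec (fun p => [~ f p, g p]) 1.
Proof.
rewrite commgEl decJ decV1 decM1; apply: eq_dec => // p.
by rewrite invg1 perm1 commgEl.
Qed.

Lemma dec_eq f g s t : dec f s = dec g t -> f =1 g /\ s = t.
Proof.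
move=> E.
have E' p q : s p :: f p q = t p :: g p q.
  by have := congr1 (fun h : sym (seq plane) => h (p :: q)) E.
split=> [p|]; first by apply: symP => q; case: (E' p q).
by apply/permP => p; case: (E' p [::]).
Qed.

Lemma head_symE a : head_sym a = dec (fun=> 1) a.
Proof. by apply: symP => -[|p q]. Qed.

Lemma bar_symE a :
  bar_sym a = dec (fun p => if p == pt1 then bar_sym a
                            else if p == pt2 then head_sym a else 1) 1.
Proof.
apply: symP => -[|p q] //=; rewrite perm1.
by case: ifP => // _; case: ifP.
Qed.

Lemma head_symM a b : head_sym (a * b) = head_sym a * head_sym b.
Proof. by rewrite !head_symE decM; apply: eq_dec => // p; rewrite mulg1. Qed.

Lemma head_sym1 : head_sym 1 = 1.
Proof. by rewrite head_symE dec1. Qed.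

Lemma head_symV a : head_sym a^-1 = (head_sym a)^-1.
Proof.
apply: (mulgI (head_sym a)).
by rewrite mulgV -head_symM mulgV head_sym1.
Qed.

Lemma bar_symM a b : bar_sym (a * b) = bar_sym a * bar_sym b.
Proof.
apply: symP; elim=> //= p s IHs; case p1: (p == pt1); first by rewrite /= p1 IHs.
case p2: (p == pt2); rewrite /= p1 p2 //.
by case: s {IHs} => //= q s; rewrite permM.
Qed.

Lemma bar_sym1 : bar_sym 1 = 1.
Proof. by apply: (mulgI (bar_sym 1)); rewrite mulg1 -bar_symM mulg1. Qed.

Lemma bar_symV a : bar_sym a^-1 = (bar_sym a)^-1.
Proof.
by apply: (mulgI (bar_sym a)); rewrite mulgV -bar_symM mulgV bar_sym1.
Qed.

Definition at_pt (r : plane) (g : sym (seq plane)) : sym (seq plane) :=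
  dec (fun p => if p == r then g else 1) 1.

Lemma at_ptM r (g h : sym (seq plane)) : at_pt r (g * h) = at_pt r g * at_pt r h.
Proof.
by rewrite /at_pt decM1; apply: eq_dec => // p; case: ifP => // _; rewrite mulg1.
Qed.

Lemma at_pt1 r : at_pt r 1 = 1.
Proof. by apply: dec1 => p; case: ifP. Qed.

Lemma at_ptV r (g : sym (seq plane)) : at_pt r g^-1 = (at_pt r g)^-1.
Proof.
by apply: (mulgI (at_pt r g)); rewrite mulgV -at_ptM mulgV at_pt1.
Qed.

(** Only the label at [r] can alter [g]. Coordinates are therefore later moved along points whose
    label is trivial. *)
Lemma at_ptJ r (g : sym (seq plane)) f s : f r = 1 -> at_pt r g ^ dec f s = at_pt (s r) g.
Proof.
move=> fr; rewrite decJ; apply: eq_dec => // p.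
rewrite (can2_eq (permKV s) (permK s)).
by case: eqP => [->|_]; rewrite ?conj1g // permK fr conjg1.
Qed.

(** An element of the base group is the product of its seven coordinate copies; the induction runs
    over partial products. *)
Lemma dec_at_pt (H : set (sym (seq plane))) f :
  is_subgroup H -> (forall r, H (at_pt r (f r))) -> H (dec f 1).
Proof.
move=> sH Hf.
suff Hs (s : seq plane) :
    uniq s -> H (dec (fun p => if p \in s then f p else 1) 1).
  have := Hs (enum 'I_7) (enum_uniq _).
  by congr H; apply: eq_dec => // p; rewrite mem_enum.
elim: s => [_|r s IHs /= /andP[rs /IHs Hs]]; first by rewrite dec1 //; exact: sH.1.
have := subgroupM sH (Hf r) Hs; congr H; rewrite decM1; apply: eq_dec => // p.
rewrite inE; case: (eqVneq p r) => [->|_] /=; last by rewrite mul1g.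
by rewrite (negbTE rs) mulg1.
Qed.

Lemma at_pt_subgroup r (H : set (sym (seq plane))) :
  is_subgroup H -> is_subgroup [set g | H (at_pt r g)].
Proof.
move=> sH; split=> [|g h Hg Hh] /=; first by rewrite at_pt1; exact: sH.1.
by rewrite at_ptM at_ptV; exact: sH.2.
Qed.

End Decomposition.

(** * Words in the three involutions and their action on the seven points *)

Inductive letter := X | Y | Z.

Definition gen (l : letter) : {perm plane} :=
  match l with X => gen_x | Y => gen_y | Z => gen_z end.

(* Indices of points start at 0. *)
Definition act (l : letter) (i : nat) : nat :=
  nth 0%N (match l with
           | X => [:: 4; 1; 6; 3; 0; 5; 2]
           | Y => [:: 0; 2; 1; 3; 4; 6; 5]
           | Z => [:: 0; 1; 2; 5; 6; 3; 4]
           end)%N i.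

Definition actw (w : seq letter) (i : nat) : nat := foldl (fun i l => act l i) i w.

Definition permw (w : seq letter) : {perm plane} := \prod_(l <- w) gen l.

Lemma pointP (P : nat -> bool) : all P (iota 0 7)%N -> forall p : plane, P p.
Proof. by move=> /allP H p; apply: H; rewrite mem_iota ltn_ord. Qed.

Lemma gen_act l (p : plane) : gen l p = act l p :> nat.
Proof.
case: p => -[|[|[|[|[|[|[|//]]]]]]] i; case: l;
  by rewrite /gen /gen_x /gen_y /gen_z permM !permE /=.
Qed.

Lemma permw_actw w (p : plane) : permw w p = actw w p :> nat.
Proof.
elim: w p => [|l w IH] p; first by rewrite /permw big_nil perm1.
by rewrite /permw big_cons permM IH /= gen_act.
Qed.

(** Identities between words in x, y, z reduce to evaluating the tables of [act] at seven
    indices. *)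
Lemma permwP v w :
  all (fun i => actw v i == actw w i) (iota 0 7)%N -> permw v = permw w.
Proof.
move=> /pointP vw; apply/permP => p; apply: val_inj.
by rewrite /= !permw_actw; exact/eqP/vw.
Qed.

Lemma permw1P w : all (fun i => actw w i == i) (iota 0 7)%N -> permw w = 1.
Proof. by move=> H; rewrite (@permwP w [::]) // /permw big_nil. Qed.

Lemma permw_cat v w : permw (v ++ w) = permw v * permw w.
Proof. exact: big_cat. Qed.

Lemma gen_permw l : gen l = permw [:: l].
Proof. by rewrite /permw big_seq1. Qed.

Lemma gen2 l : gen l * gen l = 1.
Proof. by rewrite gen_permw -permw_cat; apply: permw1P; case: l. Qed.

Lemma genV l : (gen l)^-1 = gen l.
Proof. by apply: (mulgI (gen l)); rewrite gen2 mulgV. Qed.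

Lemma permwV w : (permw w)^-1 = permw (rev w).
Proof.
elim: w => [|l w IH]; first by rewrite /permw big_nil invg1.
by rewrite rev_cons -cats1 permw_cat -gen_permw /permw big_cons invMg -/(permw w)
  IH genV.
Qed.

Lemma gen_in_A l : gen l \in A.
Proof. by apply: mem_gen; case: l; rewrite !inE eqxx ?orbT. Qed.

Lemma permw_in_A w : permw w \in A.
Proof. by apply: group_prod => l _; exact: gen_in_A. Qed.

Lemma A_gen_ind (P : {perm plane} -> Prop) :
    P 1 -> (forall l a, P a -> P (gen l * a)) -> forall a, a \in A -> P a.
Proof.
move=> P1 PM a /gen_prodgP[n [c Ac ->]].
elim: n c Ac => [|n IH] c Ac; first by rewrite big_ord0.
rewrite big_ord_recl; have := Ac ord0; rewrite !inE => /orP[/orP[]|] /eqP ->.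
- by apply: (PM X); exact: IH.
- by apply: (PM Y); exact: IH.
- by apply: (PM Z); exact: IH.
Qed.

(** * Generating triples of W *)

Lemma W_subgroup : is_subgroup W.
Proof. exact: generated_is_subgroup. Qed.

Lemma head_in_W a : a \in A -> W (head_sym a).
Proof. by move=> Aa; apply: sub_generated; left; exists a. Qed.

Lemma bar_in_W a : a \in A -> W (bar_sym a).
Proof. by move=> Aa; apply: sub_generated; right; exists a. Qed.

Lemma W_sub (H : set (sym (seq plane))) : is_subgroup H ->
    (forall l, H (head_sym (gen l))) -> (forall l, H (bar_sym (gen l))) ->
  W `<=` H.
Proof.
move=> sH Hh Hb; apply: generated_sub => // g [] [a Aa <-]; move: a Aa.
  apply: A_gen_ind => [|l b Hb']; first by rewrite head_sym1; exact: sH.1.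
  by rewrite head_symM; exact: subgroupM.
apply: A_gen_ind => [|l b Hb']; first by rewrite bar_sym1; exact: sH.1.
by rewrite bar_symM; exact: subgroupM.
Qed.

(** The generators are involutions, so [rev] inverts a word. *)
Definition commw (v w : seq letter) := rev v ++ rev w ++ v ++ w.

Lemma permw_comm v w : permw (commw v w) = [~ permw v, permw w].
Proof.
by rewrite !permw_cat -!permwV commgEl conjgE.
Qed.

(* A is perfect: [gen l = [~ [~ a, b], d]] for the following words. *)
Definition commute_words l : seq letter * seq letter * seq letter :=
  match l with
  | X => ([:: X], [:: Y], [:: Z; X; Z])
  | Y => ([:: X], [:: Y], [:: Z; Y; Z])
  | Z => ([:: X], [:: Z], [:: Y; Z; Y])
  end.

Lemma gen_comm l :
  let: (u, v, w) := commute_words l in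
  gen l = [~ [~ permw u, permw v], permw w].
Proof.
by rewrite gen_permw; case: l; rewrite /= -!permw_comm; apply: permwP.
Qed.

Lemma at_pt_gen (H : set (sym (seq plane))) r g l :
  is_subgroup H -> H (head_sym (gen l)) -> H (at_pt r g) ->
  H (at_pt (gen l r) g).
Proof.
move=> sH Hl Hr; rewrite -(@at_ptJ _ _ (fun=> 1) (gen l)) // -head_symE.
exact: subgroupJ.
Qed.

Lemma genE l (p q : plane) : act l p == q -> gen l p = q.
Proof. by move=> /eqP E; apply: val_inj; rewrite /= gen_act. Qed.

(* The points that carry the labels of the triple; generator [l] fixes them. *)
Definition marked (l : letter) (i : nat) : bool :=
  (i \in match l with X => [:: 1; 3] | Y => [:: 3; 0] | Z => [:: 0; 1] end)%N.

(* From 7 every point can be reached without passing through marked points. *)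
Lemma spread (Q : plane -> Prop) :
    (forall l (p : plane), ~~ marked l p -> Q p -> Q (gen l p)) -> Q pt7 ->
  forall p, Q p.
Proof.
move=> QS Q7.
have step l (p q : plane) : ~~ marked l p -> act l p == q -> Q p -> Q q.
  by move=> lp /genE <-; exact: QS.
have Q3 : Q pt3 by exact: (@step X pt7).
have Q6 : Q pt6 by exact: (@step Y pt7).
have Q5 : Q pt5 by exact: (@step Z pt7).
have Q2 : Q pt2 by exact: (@step Y pt3).
have Q4 : Q pt4 by exact: (@step Z pt6).
have Q1 : Q pt1 by exact: (@step X pt5).
by case=> -[|[|[|[|[|[|[|//]]]]]]] i;
  [move: Q1|move: Q2|move: Q3|move: Q4|move: Q5|move: Q6|move: Q7];
  congr Q; apply: val_inj.
Qed.

(* Conjugating by x moves the point 1 away and fixes 2, so that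
   [~ bar a, bar b ^ x] is concentrated at 2, with value [~ a, b]. *)
Lemma at_pt2_comm_in_W a b :
  a \in A -> b \in A -> W (at_pt pt2 (head_sym [~ a, b])).
Proof.
move=> Aa Ab; have sW := W_subgroup.
have := subgroupR sW (bar_in_W Aa)
  (subgroupJ sW (bar_in_W Ab) (head_in_W (gen_in_A X))).
congr W; rewrite [head_sym (gen X)]head_symE (bar_symE b) decJ (bar_symE a) decR.
apply: eq_dec => // p.
rewrite genV conjg1.
rewrite !(can2_eq (permK (gen X)) (permKV (gen X))) genV.
have -> : gen X pt1 = pt5 by exact: genE.
have -> : gen X pt2 = pt2 by exact: genE.
case: (eqVneq p pt2) => [->|p2] /=.
  by rewrite !commgEl !conjgE !head_symM !head_symV.
case: (eqVneq p pt1) => [->|p1] /=; first by rewrite commg1.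
by rewrite commgEl conj1g invg1 mulg1.
Qed.

(** A is perfect, so commutators give every [head_sym (gen l)] at 2, and A, being transitive,
    carries them to all points. *)
Lemma at_pt_in_W r g : W g -> W (at_pt r g).
Proof.
have sW := W_subgroup.
have WS s h : W (at_pt s h) -> forall p, W (at_pt p h).
  move=> Ws; have WQ l p : W (at_pt p h) -> W (at_pt (gen l p) h).
    by apply: (@at_pt_gen W) => //; exact: head_in_W (gen_in_A l).
  apply: spread => [l p _|]; first exact: WQ.
  have W' l (p q : plane) : act l p == q -> W (at_pt p h) -> W (at_pt q h).
    by move=> /genE <-; exact: WQ.
  case: s Ws => -[|[|[|[|[|[|[|//]]]]]]] i Ws.
  - apply: (W' Z pt5) => //; exact: (W' X _ pt5 _ Ws).
  - apply: (W' X pt3) => //; exact: (W' Y _ pt3 _ Ws).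
  - exact: (W' X _ pt7 _ Ws).
  - apply: (W' Y pt6) => //; exact: (W' Z _ pt6 _ Ws).
  - exact: (W' Z _ pt7 _ Ws).
  - exact: (W' Y _ pt7 _ Ws).
  - by move: Ws; congr (W (at_pt _ _)); apply: val_inj.
have Wh l p : W (at_pt p (head_sym (gen l))).
  apply: (WS pt2); have := gen_comm l.
  case: (commute_words l) => [[u v] w] ->.
  apply: at_pt2_comm_in_W; last exact: permw_in_A.
  by rewrite -permw_comm; exact: permw_in_A.
move=> Wg; apply: (W_sub (at_pt_subgroup r sW)) Wg => l /=; first exact: Wh.
apply: (WS pt1).
(* Dividing the barred generator by its copy at 2 leaves [bar_sym (gen l)] alone at 1. *)
have := subgroupM sW (bar_in_W (gen_in_A l)) (subgroupV sW (Wh l pt2)).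
congr W; rewrite {1}bar_symE -at_ptV decM1; apply: eq_dec => // p.
case: (eqVneq p pt1) => [->|_] /=; first by rewrite mulg1.
by case: ifP => _; rewrite ?mulgV ?mulg1.
Qed.

(* The labels of the points visited by each coordinate while reading a word. *)
Fixpoint trace (w : seq letter) (i : nat) : seq (letter * nat) :=
  if w is l :: w' then
    if marked l i then (l, i) :: trace w' (act l i) else trace w' (act l i)
  else [::].

Lemma head_symR a b : head_sym [~ a, b] = [~ head_sym a, head_sym b].
Proof. by rewrite !commgEl !conjgE !head_symM !head_symV. Qed.

Lemma bar_symR a b : bar_sym [~ a, b] = [~ bar_sym a, bar_sym b].
Proof. by rewrite !commgEl !conjgE !bar_symM !bar_symV. Qed.

(** * Labelled triples that generate W *)

Section LabelledTriple.
Variable c : letter -> nat -> sym (seq plane).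
Hypothesis c_unmarked : forall l i, ~~ marked l i -> c l i = 1.
Hypothesis c_invol : forall l i, c l i * c l i = 1.

Definition triple (l : letter) := dec (fun p => c l p) (gen l).

Definition section_at (w : seq letter) (i : nat) :=
  \prod_(li <- trace w i) c li.1 li.2.

Lemma prod_triple w :
  \prod_(l <- w) triple l = dec (fun p => section_at w p) (permw w).
Proof.
elim: w => [|l w IH].
  rewrite big_nil /permw big_nil dec1 // => p.
  by rewrite /section_at /= big_nil.
rewrite big_cons IH decM /permw big_cons; apply: eq_dec => // p.
rewrite /section_at /= gen_act; case: ifPn => [_|lp]; first by rewrite big_cons.
by rewrite c_unmarked // mul1g.
Qed.

Lemma triple_invol l : triple l * triple l = 1.
Proof.
rewrite decM gen2 dec1 // => p; rewrite gen_act.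
(* Marked points are fixed by their generator, and unmarked points go to unmarked ones. *)
pose P i := marked l i && (act l i == i) || ~~ marked l i && ~~ marked l (act l i).
have /orP : P p.
  by apply: (@pointP P); rewrite /P; clear P; case: l.
case => /andP[] => [_ /eqP ->|lp lp']; first exact: c_invol.
by rewrite !c_unmarked // mulg1.
Qed.

Hypothesis c_X4_Y4 : (c X 3 * c Y 3) ^+ 4 = 1.
Hypothesis c_Y1_Z1 : (c Y 0 * c Z 0) ^+ 4 = 1.
Hypothesis c_X2_Z2 : (c X 1 * c Z 1) ^+ 4 = 1.

Let H := subgroup_generated (range triple).

Let sH : is_subgroup H. Proof. exact: generated_is_subgroup. Qed.

Let triple_in_H l : H (triple l).
Proof. by apply: sub_generated; exists l. Qed.

(** The goal is that this set contains W when [L] is the complement of a line that avoids 7. *)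
Definition base_values (L : seq nat) : set (sym (seq plane)) :=
  [set g | exists f, [/\ H (dec f 1),
     forall p : plane, (p : nat) \notin L -> f p = 1 & f pt7 = g]].

Lemma base_values_subgroup L : is_subgroup (base_values L).
Proof.
split=> [|g h [f [Hf Lf <-]] [f' [Hf' Lf' <-]]].
  by exists (fun=> 1); split=> //; rewrite dec1 //; exact: sH.1.
exists (fun p => f p * (f' p)^-1); split=> //.
  by rewrite -decM1 -decV1; exact: sH.2.
by move=> p Lp; rewrite Lf // Lf' // mulgV.
Qed.

(** Conjugation by the product along [w] moves the support along [w]; since [w] returns to 7, the
    value there is conjugated by its section at 7. *)
Lemma base_valuesJ w L L' g :
    actw w 6 = 6%N -> all (fun i => actw w i \in L') L ->
  base_values L g -> base_values L' (g ^ section_at w 6).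
Proof.
move=> w6 /allP LL' [f [Hf Lf <-]].
have w7 : (permw w)^-1 pt7 = pt7.
  by rewrite -[pt7 in LHS](_ : permw w pt7 = pt7) ?permK //;
    apply: val_inj; rewrite /= permw_actw.
exists (fun p => f ((permw w)^-1 p) ^ section_at w ((permw w)^-1 p)).
split; last by rewrite w7.
  rewrite -(decJ (fun p => section_at w p)); apply: (subgroupJ sH) => //.
  by rewrite -prod_triple; exact: (subgroup_prod _ sH).
move=> p Lp; rewrite Lf ?conj1g //.
by apply: contra Lp => /LL'; rewrite -permw_actw permKV.
Qed.

Lemma base_values_word w L g :
    all (fun i => actw w i == i) (iota 0 7)%N -> section_at w 6 = g ->
    (forall i, (i < 7)%N -> i \notin L -> section_at w i = 1) ->
  base_values L g.
Proof.
move=> w1 <- w0; exists (fun p => section_at w p); split=> //.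
  by rewrite -(permw1P w1) -prod_triple; exact: (subgroup_prod _ sH).
by move=> p; exact: w0.
Qed.

Definition off145 : seq nat := [:: 1; 2; 5; 6]%N.
Definition off123 : seq nat := [:: 3; 4; 5; 6]%N.
Definition off246 : seq nat := [:: 0; 2; 4; 6]%N.
Definition off356 : seq nat := [:: 0; 1; 3; 6]%N.

(* The words xzx, yxy, zyz fix 7 with trivial section and permute the four
   complements of lines that contain 7. *)
Lemma base_values_swap L :
  L \in [:: off145; off123; off246] -> base_values L = base_values off356.
Proof.
have swap w M L' g : trace w 6 = [::] -> actw w 6 = 6%N ->
    all (fun i => actw w i \in L') M -> base_values M g -> base_values L' g.
  move=> tw w6 LL' /(base_valuesJ w6 LL').
  by rewrite /section_at tw big_nil conjg1.
rewrite !inE => /or3P[] /eqP ->; apply/seteqP; split=> g.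
- exact: (@swap [:: X; Z; X]).
- exact: (@swap [:: X; Z; X]).
- exact: (@swap [:: Y; X; Y]).
- exact: (@swap [:: Y; X; Y]).
- exact: (@swap [:: Z; Y; Z]).
- exact: (@swap [:: Z; Y; Z]).
Qed.

(** For each marked label a palindrome leads from 7 to the marked point, reads the label there, and
    returns by the same unlabelled path. It maps the support to one of the four that have the same
    values. *)
Lemma base_values_label l i g :
  base_values off356 g -> base_values off356 (g ^ c l i).
Proof.
have [|/c_unmarked ->] := boolP (marked l i); last by rewrite conjg1.
have loop w j k : trace w 6 = [:: (j, k)] -> actw w 6 = 6%N ->
    has (fun L => all (fun i => actw w i \in L) off356)
      [:: off145; off123; off246; off356] ->
    base_values off356 g -> base_values off356 (g ^ c j k).
  move=> tw w6 /hasP[L Ls LL] /(base_valuesJ w6 LL).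
  rewrite /section_at tw big_seq1.
  move: Ls; rewrite -[_ :: _]/([:: off145; off123; off246] ++ [:: off356]).
  by rewrite mem_cat => /orP[/base_values_swap ->|]; rewrite ?inE // => /eqP ->.
case: l; rewrite /marked !inE => /orP[] /eqP ->.
- exact: (@loop [:: X; Y; X; Y; X]).
- exact: (@loop [:: Y; Z; X; Z; Y]).
- exact: (@loop [:: Y; Z; Y; Z; Y]).
- exact: (@loop [:: Z; X; Y; X; Z]).
- exact: (@loop [:: Z; X; Z; X; Z]).
- exact: (@loop [:: X; Y; Z; Y; X]).
Qed.

(** These are the values at 7 of (xy)^4, (yz)^4 and (xz)^4. At the point fixed by both letters the
    section is trivial by hypothesis; on the orbit of two points the one label met occurs twice and
    cancels; on the orbit of four points, which contains 7, one label is met exactly once. *)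
Lemma base_values_power :
  [/\ base_values off145 (c X 1), base_values off123 (c Y 3)
    & base_values off246 (c Z 0)].
Proof.
have e4 (a b : sym (seq plane)) : (a * b) ^+ 4 = 1 ->
    a * (b * (a * (b * (a * (b * (a * b)))))) = 1.
  by move=> <-; rewrite !expgS expg0 mulg1 !mulgA.
split; [apply: (@base_values_word (flatten (nseq 4 [:: X; Y])))
       |apply: (@base_values_word (flatten (nseq 4 [:: Y; Z])))
       |apply: (@base_values_word (flatten (nseq 4 [:: X; Z])))] => //;
  rewrite /section_at /= ?big_seq1 //;
  (case=> [|[|[|[|[|[|[|//]]]]]]] _ //= _); rewrite ?big_cons ?big_nil ?mulg1 //=;
  by rewrite ?c_invol ?e4 ?mulgA ?c_invol ?mul1g ?c_invol.
Qed.

Hypothesis c_W : forall l i, W (c l i).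
Hypothesis W_normal_closure : forall K, is_subgroup K ->
  (forall l i g, K g -> K (g ^ c l i)) ->
  K (c X 1) -> K (c Y 3) -> K (c Z 0) -> W `<=` K.

(* The sets off145, off123 and off246 have only the point 7 in common. *)
Lemma at_pt7_comm g1 g2 g3 :
  W g1 -> W g2 -> W g3 -> H (at_pt pt7 [~ [~ g1, g2], g3]).
Proof.
have WL : W `<=` base_values off356.
  have [K1 K2 K3] := base_values_power.
  apply: W_normal_closure => [|l i g|||]; first exact: base_values_subgroup.
  - exact: base_values_label.
  - by rewrite -(@base_values_swap off145).
  - by rewrite -(@base_values_swap off123).
  - by rewrite -(@base_values_swap off246).
move=> /WL; rewrite -(@base_values_swap off145) // => -[f1 [Hf1 f10 <-]].
move=> /WL; rewrite -(@base_values_swap off123) // => -[f2 [Hf2 f20 <-]].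
move=> /WL; rewrite -(@base_values_swap off246) // => -[f3 [Hf3 f30 <-]].
have := subgroupR sH (subgroupR sH Hf1 Hf2) Hf3.
rewrite !decR; congr H; apply: eq_dec => // p.
case: eqVneq => [->|p7] //.
pose P i := [|| i == 6, i \notin off145, i \notin off123 | i \notin off246]%N.
have : P p by exact: (@pointP P).
case/or4P => [/eqP p6|/f10 ->|/f20 ->|/f30 ->].
- by case/eqP: p7; apply: val_inj.
- by rewrite !comm1g.
- by rewrite commg1 comm1g.
- exact: commg1.
Qed.

(** As A is perfect, the generators of W are double commutators, which gives all of W at 7.
    Conjugation by the triple along unlabelled moves then reaches the other points. *)
Lemma at_pt_in_generated p g : W g -> H (at_pt p g).
Proof.
move=> Wg; move: p; apply: spread => [l p lp Hp|].
  rewrite -(@at_ptJ _ _ (fun p => c l p)) ?c_unmarked //.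
  exact: (subgroupJ sH Hp (triple_in_H l)).
apply: (W_sub (at_pt_subgroup pt7 sH)) Wg => l /=; have := gen_comm l;
  case: (commute_words l) => [[u v] w] ->.
- by rewrite !head_symR; apply: at_pt7_comm; exact: head_in_W (permw_in_A _).
- by rewrite !bar_symR; apply: at_pt7_comm; exact: bar_in_W (permw_in_A _).
Qed.

(** Once all coordinate copies of W are in [H], the labels can be divided off, which leaves A; the
    barred generators lie in the base group. *)
Lemma triple_generates : H = W.
Proof.
have sW := W_subgroup.
have Hh l : H (head_sym (gen l)).
  have Hc : H (dec (fun p => c l p) 1).
    by apply: (dec_at_pt sH) => r; exact: at_pt_in_generated.
  have := subgroupM sH (subgroupV sH Hc) (triple_in_H l).
  congr H; rewrite decV1 decM head_symE; apply: eq_dec => [p|].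
    by rewrite perm1 mulVg.
  by rewrite mul1g.
apply/seteqP; split.
  apply: generated_sub => // _ [l _ <-].
  rewrite (_ : triple l = dec (fun p => c l p) 1 * head_sym (gen l)).
    apply: (subgroupM sW); last exact: head_in_W (gen_in_A l).
    by apply: (dec_at_pt sW) => r; exact: at_pt_in_W.
  rewrite head_symE decM mul1g; apply: eq_dec => // p.
  by rewrite mulg1.
apply: (W_sub sH) => // l; rewrite bar_symE; apply: (dec_at_pt sH) => r.
apply: at_pt_in_generated; case: ifP => _; first exact: bar_in_W (gen_in_A l).
by case: ifP => _; [exact: head_in_W (gen_in_A l)|exact: sW.1].
Qed.

End LabelledTriple.

(* In the inductive step only one of the two marked points is used. *)
Definition mark (l : letter) : nat :=
  match l with X => 1%N | Y => 3%N | Z => 0%N end.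

Definition lift_labels (t : letter -> sym (seq plane)) (l : letter) (i : nat) :=
  if i == mark l then t l else 1.

Lemma lift_labels_unmarked t l i : ~~ marked l i -> lift_labels t l i = 1.
Proof. by rewrite /lift_labels; case: eqP => // ->; case: l. Qed.

Lemma lift_labels_invol t : (forall l, t l * t l = 1) ->
  forall l i, lift_labels t l i * lift_labels t l i = 1.
Proof. by move=> t2 l i; rewrite /lift_labels; case: ifP => // _; rewrite mulg1. Qed.

(** Of the two labels in each required fourth power one is trivial and the other an involution, and
    the three labels tested for normal generation are [t] itself. *)
Lemma lift_generates t :
    (forall l, t l * t l = 1) -> subgroup_generated (range t) = W ->
  subgroup_generated (range (triple (lift_labels t))) = W.
Proof.
move=> t2 tW.
have Wt l : W (t l) by rewrite -tW; apply: sub_generated; exists l.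
apply: triple_generates.
- exact: lift_labels_unmarked.
- exact: lift_labels_invol.
- by rewrite /lift_labels /= mul1g expgS -expgS !expgS expg0 mulg1 mulgA !t2 mulg1.
- by rewrite /lift_labels /= mul1g !expgS expg0 mulg1 mulgA !t2 mulg1.
- by rewrite /lift_labels /= mulg1 !expgS expg0 mulg1 mulgA !t2 mulg1.
- move=> l i; rewrite /lift_labels; case: ifP => // _.
  by have [] := W_subgroup.
- move=> K sK _ KX KY KZ; rewrite -tW; apply: generated_sub => // _ [[] _ <-] //.
Qed.

(** Two letters that mark the same point carry labels in the same copy of A, where their product has
    order 4, except at 1, where the two labels commute. *)
Definition base_labels (l : letter) (i : nat) : sym (seq plane) :=
  match l, i with
  | X, 1%N => bar_sym gen_x
  | X, 3%N => head_sym gen_x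
  | Y, 3%N => head_sym gen_y
  | Y, 0%N => bar_sym gen_y
  | Z, 0%N => head_sym gen_z
  | Z, 1%N => bar_sym gen_z
  | _, _ => 1
  end.

Lemma head_gen2 l : head_sym (gen l) * head_sym (gen l) = 1.
Proof. by rewrite -head_symM gen2 head_sym1. Qed.

Lemma bar_gen2 l : bar_sym (gen l) * bar_sym (gen l) = 1.
Proof. by rewrite -bar_symM gen2 bar_sym1. Qed.

Lemma gen_conj l m : exists w, gen m = gen l ^ permw w.
Proof.
suff [w Ew] : exists w, permw (rev w ++ l :: w) = gen m.
  by exists w; rewrite -Ew permw_cat -permwV conjgE /permw big_cons.
case: l; case: m; rewrite gen_permw.
- by exists [::].
- by exists [:: Z; Y; Z; X; Z]; exact: permwP.
- by exists [:: Y; Z; Y; X; Y]; exact: permwP.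
- by exists [:: Z; X; Z; Y; Z]; exact: permwP.
- by exists [::].
- by exists [:: X; Z; X; Y; X]; exact: permwP.
- by exists [:: Y; X; Y; Z; Y]; exact: permwP.
- by exists [:: X; Y; X; Z; X]; exact: permwP.
- by exists [::].
Qed.

(** Follows the conjugating word of [gen_conj] letter by letter; [f] will be either embedding of
    A. *)
Lemma conj_closed_word (K : set (sym (seq plane))) (f : {perm plane} -> sym (seq plane)) :
    f 1 = 1 -> {morph f : a b / a * b} ->
    (forall l g, K g -> K (g ^ f (gen l))) ->
  forall l m, K (f (gen l)) -> K (f (gen m)).
Proof.
move=> f1 fM KJ l m Kl; have fV a : f a^-1 = (f a)^-1.
  by apply: (mulgI (f a)); rewrite mulgV -fM mulgV.
have [w ->] := gen_conj l m; rewrite conjgE !fM fV -conjgE.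
elim/last_ind: w => [|w k IH]; first by rewrite /permw big_nil f1 conjg1.
rewrite -cats1 permw_cat -gen_permw fM conjgM; exact: KJ.
Qed.

Lemma base_labels_unmarked l i : ~~ marked l i -> base_labels l i = 1.
Proof. by case: l; case: i => [|[|[|[|i]]]]. Qed.

Lemma base_labels_invol l i : base_labels l i * base_labels l i = 1.
Proof.
have h2 m := head_gen2 m; have b2 m := bar_gen2 m.
case: l; case: i => [|[|[|[|i]]]] /=; rewrite ?mulg1 //;
  by [exact: (h2 X)|exact: (h2 Y)|exact: (h2 Z)
     |exact: (b2 X)|exact: (b2 Y)|exact: (b2 Z)].
Qed.

Lemma base_generates : subgroup_generated (range (triple base_labels)) = W.
Proof.
have W1 : W 1 := W_subgroup.1.
have Wh l := head_in_W (gen_in_A l); have Wb l := bar_in_W (gen_in_A l).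
have h2 := head_gen2; have b2 := bar_gen2.
have word4 l m : (gen l * gen m) ^+ 4 = 1.
  rewrite (_ : gen l * gen m = permw [:: l; m]); last first.
    by rewrite /permw !big_cons big_nil mulg1.
  by rewrite !expgS expg0 mulg1 -!permw_cat; apply: permw1P; case: l; case: m.
apply: triple_generates => //.
- exact: base_labels_unmarked.
- exact: base_labels_invol.
- rewrite /= -head_symM !expgS expg0 mulg1 -!head_symM -head_sym1.
  by congr head_sym; have := word4 X Y; rewrite !expgS expg0 mulg1.
(* As z fixes 1 and 2, conjugation by it leaves the two nontrivial coordinates of [bar_sym gen_y] in
   place. *)
- have comm : commute (bar_sym gen_y) (head_sym gen_z).
    apply/commgP/eqP; rewrite commgEl head_symE {2}bar_symE decJ.
    apply: (mulgI (bar_sym gen_y)); rewrite mulVKg mulg1 [RHS]bar_symE.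
    apply: eq_dec => // p; rewrite conjg1 !(can2_eq (permKV gen_z) (permK gen_z)).
    have -> : gen_z pt1 = pt1 by exact: (@genE Z).
    by have -> : gen_z pt2 = pt2 by exact: (@genE Z).
  rewrite /= expgMn // !expgS expg0 mulg1 !mulgA.
  by rewrite (b2 Y) mul1g (b2 Y) mul1g (h2 Z) mul1g (h2 Z) mul1g expg0.
- rewrite /= -bar_symM !expgS expg0 mulg1 -!bar_symM -bar_sym1.
  by congr bar_sym; have := word4 X Z; rewrite !expgS expg0 mulg1.
- case=> -[|[|[|[|i]]]] //=;
    by [exact: (Wh X)|exact: (Wh Y)|exact: (Wh Z)
       |exact: (Wb X)|exact: (Wb Y)|exact: (Wb Z)].
move=> K sK KJ KX KY KZ; apply: (W_sub sK) => l.
  apply: (conj_closed_word head_sym1 head_symM _ (l := Y)) => // m g.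
  by case: m; [exact: (KJ X 3%N)|exact: (KJ Y 3%N)|exact: (KJ Z 0%N)].
apply: (conj_closed_word bar_sym1 bar_symM _ (l := X)) => // m g.
by case: m; [exact: (KJ X 1%N)|exact: (KJ Y 0%N)|exact: (KJ Z 1%N)].
Qed.

(** * Contraction and counting of words *)

Local Close Scope group_scope.

Definition letter_code (l : letter) : nat :=
  match l with X => 0 | Y => 1 | Z => 2 end.

Fact letter_code_inj : injective letter_code.
Proof. by do 2 case. Qed.

HB.instance Definition _ := Equality.copy letter (inj_type letter_code_inj).

Definition prodw (t : letter -> sym (seq plane)) (w : seq letter) :=
  (\prod_(l <- w) t l)%g.

(* A state records, for each position, the last letter contributed to the
   coordinate that is currently there. *)
Definition state := seq (option letter).

Definition blank : state := nseq 7 None.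

(* [None] means that a square of a letter appears in some coordinate. *)
Definition step (l : letter) (st : state) : option state :=
  if nth None st (mark l) == Some l then None
  else let st' := set_nth None st (mark l) (Some l) in
       Some [seq nth None st' (act l i) | i <- iota 0 7].

(** After a square the state is reset to [blank]: cancellations that use older letters are not
    counted, and the count for the rest of the word depends on that rest alone. *)
Fixpoint cancels (st : state) (w : seq letter) : nat :=
  if w is l :: w' then
    if step l st is Some st' then cancels st' w' else (cancels blank w').+1
  else 0.

Definition mark_pt (l : letter) : plane :=
  match l with X => pt2 | Y => pt4 | Z => pt1 end.

Lemma mark_ptE l : mark_pt l = mark l :> nat.
Proof. by case: l. Qed.

Lemma triple_lift t l :
  triple (lift_labels t) l = dec (fun p => if p == mark_pt l then t l else 1%g) (gen l).
Proof. by apply: eq_dec => // p; rewrite /lift_labels; case: l. Qed.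

Definition total (v : plane -> seq letter) : nat := \sum_p size (v p).

Lemma sum_size_at (u v : plane -> seq letter) (p0 : plane) :
    (forall p, p != p0 -> u p = v p) ->
  total v + size (u p0) = total u + size (v p0).
Proof.
move=> uv; rewrite /total (bigD1 p0) //= [in RHS](bigD1 p0) //=.
rewrite addnAC [RHS]addnAC [size (u p0) + _]addnC; congr (_ + _).
by apply: eq_bigr => p /uv ->.
Qed.

Lemma genK l : involutive (gen l).
Proof. by move=> p; rewrite -permM gen2 perm1. Qed.

(** Each letter is appended to one coordinate word. If the state shows the same letter there, that
    last letter is deleted instead, so the total drops by 1 rather than growing by 1. *)
Lemma contraction t (st : state) (v : plane -> seq letter) (s : {perm plane}) w :
    (forall l, t l * t l = 1)%g ->
    (forall p l, nth None st (s p) = Some l -> exists u, v p = rcons u l) ->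
  exists v' s',
    (dec (fun p => prodw t (v p)) s * prodw (triple (lift_labels t)) w)%g =
      dec (fun p => prodw t (v' p)) s' /\
    total v' + 2 * cancels st w <= total v + size w.
Proof.
move=> t2; elim: w st v s => [|l w IH] st v s vst.
  by exists v, s; rewrite /prodw big_nil mulg1 muln0 addn0.
pose p0 := (s^-1)%g (mark_pt l).
have sp0 : s p0 = mark_pt l by rewrite permKV.
have spE p : (s p == mark_pt l) = (p == p0).
  by rewrite -[in RHS](inj_eq (@perm_inj _ s)) sp0.
have mul_first u : (forall p, prodw t (u p) = if p == p0 then prodw t (v p) * t l
                                               else prodw t (v p))%g ->
    (dec (fun p => prodw t (v p)) s * prodw (triple (lift_labels t)) (l :: w))%g =
    (dec (fun p => prodw t (u p)) (s * gen l) *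
      prodw (triple (lift_labels t)) w)%g.
  move=> Hu; rewrite /prodw big_cons mulgA triple_lift decM.
  congr (_ * _)%g; apply: eq_dec => // p.
  by rewrite spE [RHS]Hu; case: eqP => // _; rewrite mulg1.
rewrite /= /step; case: eqP => [cancel|nocancel].
  have [u0 vp0] : exists u, v p0 = rcons u l.
    by apply: vst; rewrite sp0 mark_ptE.
  pose u p := if p == p0 then u0 else v p.
  have [|v' [s' [Ev' le_v']]] := IH blank u (s * gen l)%g.
    by move=> p m; rewrite /blank nth_nseq if_same.
  exists v', s'; split.
    rewrite -Ev' (mul_first u) // => p; rewrite /u; case: eqP => [->|//].
    by rewrite vp0 /prodw -cats1 big_cat big_seq1 /= -mulgA t2 mulg1.
  have := sum_size_at (u := u) (v := v) (p0 := p0).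
  rewrite vp0 size_rcons {2}/u eqxx => E; move: le_v'.
  suff: total v = total u + 1 by lia.
  by apply/eqP; rewrite -(eqn_add2r (size u0)) E ?addn1 ?addSnnS // => p /negbTE;
    rewrite /u => ->.
pose u p := if p == p0 then rcons (v p) l else v p.
set st' := map _ _.
have [|v' [s' [Ev' le_v']]] := IH st' u (s * gen l)%g.
  move=> p m; rewrite permM /st' (nth_map 0) ?size_iota //.
  rewrite nth_iota // add0n -gen_act genK nth_set_nth /= /u -spE.
  rewrite -mark_ptE val_eqE.
  by case: eqP => [_ [<-]|_]; [exists (v p)|exact: vst].
exists v', s'; split.
  rewrite -Ev' (mul_first u) // => p; rewrite /u; case: eqP => // _.
  by rewrite /prodw -cats1 big_cat big_seq1.
have := sum_size_at (u := u) (v := v) (p0 := p0).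
rewrite {2}/u eqxx size_rcons => E; move: le_v'.
suff: total u = total v + 1 by lia.
by apply/eqP; rewrite -(eqn_add2r (size (v p0))) -E ?addn1 ?addSnnS // => p /negbTE;
  rewrite /u => ->.
Qed.

(** * Counting the words with few cancellations *)

Definition next (st : state) : seq state := pmap (step^~ st) [:: X; Y; Z].

(** One entry for each word of length [n] that does not cancel, namely the state it leads to. *)
Definition level (n : nat) : seq state :=
  iter n (fun L => flatten (map next L)) [:: blank].

Lemma levelS n : level n.+1 = flatten (map next (level n)).
Proof. by []. Qed.

(* The words that do not cancel are, up to their first and last letters, the
   factors of the periodic words (xyz)^oo and (zyx)^oo. *)
Lemma perm_level n : perm_eq (level (n + 8)) (level 8).
Proof.
elim: n => [|n IH] //; apply: (@perm_trans _ (level 9)); last by vm_compute.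
by rewrite !levelS; apply/perm_flatten/perm_map.
Qed.

Lemma size_level n : size (level n) <= 12.
Proof.
have [/subnK <-|] := leqP 8 n; first by rewrite (perm_size (perm_level _)).
by move: n; do 8 case=> //.
Qed.

Fixpoint words (n : nat) : seq (seq letter) :=
  if n is n'.+1 then [seq l :: w | l <- [:: X; Y; Z], w <- words n'] else [:: [::]].

Lemma mem_words w : w \in words (size w).
Proof.
elim: w => //= l w IH; rewrite cats0 !mem_cat.
by case: l; rewrite (map_f _ IH) ?orbT.
Qed.

Lemma size_words n : size (words n) = 3 ^ n.
Proof. by elim: n => //= n IH; rewrite expnS !size_cat !size_map IH /=; lia. Qed.

Local Open Scope ring_scope.

Section CountingWords.
Variables (R : realType) (t : R).
Hypothesis t_ge0 : 0 <= t.

(** The generating function of the number of cancellations, evaluated at [t]. *)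
Definition weight st n := \sum_(w <- words n) t ^+ cancels st w.

Lemma weight0 st : weight st 0 = 1.
Proof. by rewrite /weight big_seq1. Qed.

Lemma weight_ge0 st n : 0 <= weight st n.
Proof. by apply: sumr_ge0 => w _; exact: exprn_ge0. Qed.

Lemma weightS st n : weight st n.+1 =
  \sum_(l <- [:: X; Y; Z])
    if step l st is Some st' then weight st' n else t * weight blank n.
Proof.
rewrite /weight -[words n.+1]/[seq l :: w | l <- [:: X; Y; Z], w <- words n].
rewrite big_allpairs_dep; apply: eq_bigr => l _ /=.
case: (step l st) => // ; rewrite mulr_sumr; apply: eq_bigr => w _.
by rewrite exprS.
Qed.

(** A state has three continuations; each either leads to the next level or cancels, at the price of
    a factor [t] and a restart from [blank]. *)
Lemma weight_levels L n :
  \sum_(st <- L) weight st n.+1 <=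
    \sum_(st <- flatten (map next L)) weight st n +
    3 * (size L)%:R * (t * weight blank n).
Proof.
have tb_ge0 : 0 <= t * weight blank n by rewrite mulr_ge0 ?weight_ge0.
elim: L => [|st L IH]; first by rewrite !big_nil mulr0 mul0r addr0.
rewrite big_cons /= big_cat /= -(natr1 (size L)) mulrDr mulr1 mulrDl.
suff : weight st n.+1 <= \sum_(i <- next st) weight i n + 3 * (t * weight blank n).
  by move: IH; set a := _ * _ * _; lra.
rewrite weightS /next !big_cons big_nil /=.
by case: (step X st) => [?|]; case: (step Y st) => [?|]; case: (step Z st) => [?|];
  rewrite /= ?big_cons ?big_nil; lra.
Qed.

(** Each level has at most 12 states, hence at most 36 cancelling continuations. All levels are
    bounded together by induction on the number of letters left. *)
Lemma weight_level_le m n :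
  \sum_(st <- level m) weight st n <= 12 * (1 + 36 * t) ^+ n.
Proof.
elim: n m => [|n IH] m.
  under eq_bigr do rewrite weight0.
  rewrite big_const_seq count_predT iter_addr_0 expr0 mulr1 ler_nat.
  exact: size_level.
apply: le_trans (weight_levels _ _) _.
have := IH m.+1; have := IH 0; rewrite {1}/level /= big_seq1 => IH0 IH1.
rewrite exprS; set q := (1 + 36 * t) ^+ n in IH0 IH1 *.
have tb : t * weight blank n <= t * (12 * q) by rewrite ler_wpM2l.
have sz : 3 * (size (level m))%:R * (t * weight blank n) <= 36 * (t * weight blank n).
  apply: ler_wpM2r; first by rewrite mulr_ge0 ?weight_ge0.
  by rewrite -natrM ler_nat (leq_trans (leq_mul (leqnn 3) (size_level m))).
by move: IH1; lra.
Qed.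

(** A Markov inequality: as [t] is at most 1, each word counted has weight at least [t ^+ r]. *)
Lemma count_few_cancels n r : t <= 1 ->
  (size [seq w <- words n | cancels blank w <= r]%N)%:R * t ^+ r <=
    12 * (1 + 36 * t) ^+ n.
Proof.
move=> t_le1; have := weight_level_le 0 n; rewrite {1}/level /= big_seq1.
apply: le_trans.
rewrite size_filter -sum1_count natr_sum mulr_suml /weight [leRHS]big_mkcond /=.
rewrite big_mkcond /=; apply: ler_sum => w _.
case: ifP => [le_r|_]; last exact: exprn_ge0.
by rewrite mul1r ler_wiXn2l.
Qed.

End CountingWords.

(** * Growth exponents of the iterated triples *)

Fixpoint gens (k : nat) : letter -> sym (seq plane) :=
  if k is k'.+1 then triple (lift_labels (gens k')) else triple base_labels.

Lemma gens_invol k l : (gens k l * gens k l = 1)%g.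
Proof.
elim: k l => [|k IH] l /=; apply: triple_invol.
- exact: base_labels_unmarked.
- exact: base_labels_invol.
- exact: lift_labels_unmarked.
- exact: lift_labels_invol.
Qed.

Lemma gens_generate k : subgroup_generated (range (gens k)) = W.
Proof.
elim: k => [|k IH]; first exact: base_generates.
by apply: lift_generates => //; exact: gens_invol.
Qed.

(** The bound (1 - 2 / q) n with the denominator cleared. The hypothesis on [q] covers the case in
    which the subtraction truncates to 0. *)
Lemma mul_sub_divn q n :
  (2 <= q -> q * (n - 2 * (n %/ q).+1) + 2 * n <= q * n)%N.
Proof.
move=> q2; have : (n < (n %/ q).+1 * q)%N by rewrite ltn_ceil // ltnW.
move: (n %/ q).+1 => r nr; have [|lt_n] := leqP (2 * r) n; last first.
  by rewrite (_ : n - 2 * r = 0)%N ?muln0 ?leq_mul2r ?q2 ?orbT //; lia.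
by move=> /subnK {3}<-; rewrite mulnDr leq_add2l mulnCA leq_mul2l mulnC ltnW.
Qed.

Lemma leq_sub_cancels m k r n :
  (m + 2 * k <= 0 + n -> r < k -> m <= n - 2 * r.+1)%N.
Proof. lia. Qed.

Section GrowthBounds.
Variable R : realType.
Implicit Types (a b C tau : R) (t : letter -> sym (seq plane)).

Definition growth_le t a := exists2 C, 0 <= C & forall n,
  exists2 L : seq (sym (seq plane)), (size L)%:R <= C * expR (a * n%:R) &
    forall w, size w = n -> prodw t w \in L.

(** The first word has one of [M.+1] possible lengths; each word contributes a factor [C], and the
    exponentials multiply up to the total length. *)
Lemma expR_prod_bound a C t k M : 0 <= a -> 0 <= C ->
    (forall n, exists2 L : seq (sym (seq plane)), (size L)%:R <= C * expR (a * n%:R) &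
      forall w, size w = n -> prodw t w \in L) ->
  exists2 P : seq (seq (sym (seq plane))),
    (size P)%:R <= (C * M.+1%:R) ^+ k * expR (a * M%:R) &
    forall vs, size vs = k -> (sumn (map size vs) <= M)%N ->
      map (prodw t) vs \in P.
Proof.
move=> a_ge0 C_ge0 HL; elim: k M => [|k IH] M.
  exists [:: [::]]; last by case.
  by rewrite expr0 mul1r /= -[leLHS]expR0 ler_expR mulr_ge0.
have [L Ls Lw] : {L : nat -> seq (sym (seq plane)) &
    (forall n, (size (L n))%:R <= C * expR (a * n%:R)) &
    (forall n w, size w = n -> prodw t w \in L n)}.
  have /choice[L HL'] n : exists L : seq (sym (seq plane)),
    (size L)%:R <= C * expR (a * n%:R) /\ forall w, size w = n -> prodw t w \in L.
    by have [L ? ?] := HL n; exists L.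
  by exists L => n; have [] := HL' n.
have [P Ps Pv] : {P : nat -> seq (seq (sym (seq plane))) &
    (forall m, (size (P m))%:R <= (C * m.+1%:R) ^+ k * expR (a * m%:R)) &
    (forall m vs, size vs = k -> (sumn (map size vs) <= m)%N ->
       map (prodw t) vs \in P m)}.
  have /choice[P HP] m : exists P : seq (seq (sym (seq plane))),
    (size P)%:R <= (C * m.+1%:R) ^+ k * expR (a * m%:R) /\
    (forall vs, size vs = k -> (sumn (map size vs) <= m)%N ->
       map (prodw t) vs \in P).
    by have [P ? ?] := IH m; exists P.
  by exists P => m; have [] := HP m.
exists (flatten [seq [seq g :: s | g <- L m, s <- P (M - m)%N] | m <- iota 0 M.+1]).
  rewrite size_flatten /shape -map_comp sumnE big_map natr_sum.
  apply: (@le_trans _ _ (\sum_(m <- iota 0 M.+1)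
                           C * (C * M.+1%:R) ^+ k * expR (a * M%:R))).
    rewrite !big_seq; apply: ler_sum => m; rewrite mem_iota add0n ltnS => /= mM.
    rewrite size_allpairs natrM.
    apply: (@le_trans _ _ (C * expR (a * m%:R) *
        ((C * M.+1%:R) ^+ k * expR (a * (M - m)%:R)))).
      apply: ler_pM => //; apply: le_trans (Ps _) _.
      rewrite ler_pM2r ?expR_gt0 // lerXn2r ?nnegrE ?mulr_ge0 //.
      by rewrite ler_wpM2l // ler_nat ltnS leq_subr.
    rewrite le_eqVlt; apply/orP; left; apply/eqP.
    rewrite [a * M%:R](_ : _ = a * m%:R + a * (M - m)%:R) ?expRD; first ring.
    by rewrite -mulrDr -natrD subnKC.
  rewrite big_const_seq count_predT size_iota iter_addr_0 -mulr_natr.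
  rewrite le_eqVlt; apply/orP; left; apply/eqP; rewrite exprS; ring.
case=> // v vs [szvs] le_M; apply/flattenP; rewrite /= in le_M.
have vM : (size v <= M)%N by rewrite (leq_trans _ le_M) // leq_addr.
exists [seq g :: s | g <- L (size v), s <- P (M - size v)%N].
  by apply/mapP; exists (size v); rewrite // mem_iota add0n ltnS.
apply: allpairs_f; first exact: Lw.
by apply: Pv => //; rewrite leq_subRL.
Qed.

Lemma dec_bound a C t M : 0 <= a -> 0 <= C ->
    (forall n, exists2 L : seq (sym (seq plane)), (size L)%:R <= C * expR (a * n%:R) &
      forall w, size w = n -> prodw t w \in L) ->
  exists2 Q : seq (sym (seq plane)),
    (size Q)%:R <= (size (enum {perm plane}))%:R * (C * M.+1%:R) ^+ 7 * expR (a * M%:R) &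
    forall v s, (total v <= M)%N -> dec (fun p => prodw t (v p)) s \in Q.
Proof.
move=> a_ge0 C_ge0 /(@expR_prod_bound _ _ _ 7 M a_ge0 C_ge0)[P sP memP].
exists [seq dec (fun p => nth 1%g x p) s | x <- P, s <- enum {perm plane}].
  rewrite size_allpairs mulnC natrM -mulrA ler_wpM2l //.
move=> v s vM; apply/allpairsP.
exists (map (prodw t) (map v (enum 'I_7)), s); split=> /=.
- apply: memP; first by rewrite size_map size_enum_ord.
  by rewrite sumnE !big_map; exact: vM.
- by rewrite mem_enum.
apply: eq_dec => // p.
by rewrite -map_comp (nth_map p) ?size_enum_ord // nth_ord_enum.
Qed.

Lemma poly_le_expR (k : nat) b : 0 < b ->
  exists2 C, 0 <= C & forall n : nat, n.+1%:R ^+ k <= C * expR (b * n%:R).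
Proof.
case: k => [|k] b_gt0.
  by exists 1 => // n; rewrite expr0 mul1r -[leLHS]expR0 ler_expR mulr_ge0 // ltW.
(* Splitting [b] into equal parts reduces the claim to the power of a linear bound, which follows
   from 1 + y <= e^y. *)
pose d := b / k.+1%:R.
have d_gt0 : 0 < d by rewrite divr_gt0.
exists ((d^-1 * expR d) ^+ k.+1) => [|n].
  by rewrite exprn_ge0 // mulr_ge0 ?invr_ge0 ?expR_ge0 // ltW.
have -> : expR (b * n%:R) = expR (d * n%:R) ^+ k.+1.
  rewrite -expRM_natl; congr expR; rewrite /d; field.
  by rewrite nat1r pnatr_eq0.
rewrite -exprMn lerXn2r ?nnegrE //.
  by rewrite !mulr_ge0 ?invr_ge0 ?expR_ge0 // ltW.
rewrite -mulrA -expRD ler_pdivlMl // mulrC.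
have -> : d + d * n%:R = d * n.+1%:R by rewrite -nat1r; ring.
by rewrite mulrC; apply: le_trans (expR_ge1Dx _); rewrite lerDr.
Qed.

(* A word of length n cancels at most n / q times, and then it is one of few, or
   its sections have total length at most (1 - 2 / q) n. *)
Lemma growth_step tau : 0 < tau -> exists2 q : nat, (0 < q)%N &
  forall t a b, (forall l, t l * t l = 1)%g -> growth_le t a ->
    0 < a -> tau <= b -> a * (1 - q%:R^-1) <= b ->
  growth_le (triple (lift_labels t)) b.
Proof.
move=> tau_gt0.
(* Then 1 + 36 x <= e^(tau / 2), so the weights account for half of the exponent tau. *)
pose x := Num.min 1 (tau / 72).
have x_gt0 : 0 < x by rewrite lt_min ltr01 divr_gt0.
have x_le1 : x <= 1 by rewrite ge_min lexx.
have x_tau : 1 + 36 * x <= expR (tau / 2).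
  apply: le_trans (expR_ge1Dx _); rewrite lerD2l.
  have : x <= tau / 72 by rewrite ge_min lexx orbT.
  lra.
(* Then 1 / x <= e^(tau q / 2), so dividing by x^r with r <= n / q costs the other half of tau. The
   offset ensures that q is at least 2. *)
pose q := (Num.truncn (2 / (tau * x))).+2.
have q_gt0 : (0 : R) < q%:R by rewrite ltr0n.
have xq : 1 <= x * expR (tau / 2 * q%:R).
  have : 2 / (tau * x) <= q%:R.
    apply/ltW/(lt_trans (truncnS_gt _)); by rewrite ltr_nat.
  rewrite ler_pdivrMr ?mulr_gt0 // => le_q.
  apply: (@le_trans _ _ (x * (1 + tau / 2 * q%:R))).
    by nra.
  by rewrite ler_pM2l // expR_ge1Dx.
exists q => // t a b t2 [C C_ge0 HC] a_gt0 tau_b ab.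
(* Of the saving 2 a / q one half is spent here, on absorbing the factor (M + 1)^7 from the seven
   coordinates. *)
have [D D_ge0 HD] := @poly_le_expR 7 (a / q%:R) (divr_gt0 a_gt0 q_gt0).
pose E := (size (enum {perm plane}))%:R * C ^+ 7 * D.
have E_ge0 : 0 <= E by rewrite !mulr_ge0 ?exprn_ge0.
exists (12 + E) => [|n]; first exact: addr_ge0.
pose r := (n %/ q)%N; pose M := (n - 2 * r.+1)%N.
have [Q Qs Qm] := @dec_bound a C t M (ltW a_gt0) C_ge0 HC.
exists (map (prodw (triple (lift_labels t)))
          [seq w <- words n | cancels blank w <= r]%N ++ Q); last first.
  move=> w wn; rewrite mem_cat; case: (leqP (cancels blank w) r) => [wr|rw].
    by apply/orP; left; apply: map_f; rewrite mem_filter wr -wn mem_words.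
  apply/orP; right.
  have [|v [s [Ev]]] := @contraction t blank (fun=> [::]) 1%g w t2.
    by move=> p l; rewrite /blank nth_nseq if_same.
  rewrite (@dec1 (fun=> prodw t [::])) in Ev; last by move=> p; rewrite /prodw big_nil.
  rewrite mul1g in Ev; rewrite Ev => le_v; apply: Qm.
  move: le_v; rewrite {2}/total big1 // wn => le_v; exact: (leq_sub_cancels le_v).
rewrite size_cat size_map natrD mulrDl; apply: lerD.
  have := @count_few_cancels R x (ltW x_gt0) n r x_le1.
  set N := (size _)%:R => le_N.
  apply: (@le_trans _ _ (12 * expR (tau * n%:R))); last first.
    by rewrite ler_pM2l // ler_expR ler_wpM2r.
  have rq : (r * q <= n)%N by exact: leq_divM.
  have xr : 1 <= x ^+ r * expR (tau / 2 * n%:R).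
    apply: (@le_trans _ _ ((x * expR (tau / 2 * q%:R)) ^+ r)).
      exact: exprn_ege1.
    rewrite exprMn ler_pM2l ?exprn_gt0 // -expRM_natl ler_expR.
    rewrite (_ : _ * (_ * _) = tau / 2 * (r * q)%:R); last by rewrite natrM; ring.
    by rewrite ler_pM2l ?ler_nat ?divr_gt0.
  have nq : (1 + 36 * x) ^+ n <= expR (tau / 2 * n%:R).
    rewrite [tau / 2 * _]mulrC expRM_natl lerXn2r ?nnegrE ?expR_ge0 //.
    by rewrite addr_ge0 // mulr_ge0 // ltW.
  have -> : tau * n%:R = tau / 2 * n%:R + tau / 2 * n%:R by field.
  rewrite expRD mulrA; set e := expR _ in xr nq *.
  have e_gt0 : 0 < e by exact: expR_gt0.
  apply: (@le_trans _ _ (N * x ^+ r * e)).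
    by rewrite -mulrA ler_peMr.
  rewrite ler_pM2r //; apply: (le_trans le_N).
  by rewrite ler_pM2l.
apply: (le_trans Qs).
have M_n : a * M%:R <= a * (1 - q%:R^-1) * n%:R - a / q%:R * n%:R.
  have qM : (q * M + 2 * n <= q * n)%N.
    by exact: mul_sub_divn.
  have -> : a * (1 - q%:R^-1) * n%:R - a / q%:R * n%:R =
     a * ((q%:R * n%:R - 2 * n%:R) / q%:R) by field; rewrite gt_eqF.
  rewrite ler_pM2l // ler_pdivlMr // lerBrDr mulrC -!natrM -natrD ler_nat //.
apply: (@le_trans _ _ (E * expR (a * (1 - q%:R^-1) * n%:R))); last first.
  by rewrite ler_wpM2l // ler_expR ler_wpM2r.
have -> : E * expR (a * (1 - q%:R^-1) * n%:R) =
    (size (enum {perm plane}))%:R * C ^+ 7 * (D * expR (a / q%:R * n%:R)) *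
    expR (a * (1 - q%:R^-1) * n%:R - a / q%:R * n%:R).
  by rewrite expRD expRN /E; field; rewrite gt_eqF ?expR_gt0.
apply: ler_pM; [|exact: expR_ge0| |by rewrite ler_expR].
  by rewrite mulr_ge0 // exprn_ge0 // mulr_ge0.
rewrite exprMn [leLHS]mulrA ler_wpM2l ?mulr_ge0 ?exprn_ge0 //.
apply: le_trans (HD n); rewrite lerXn2r ?nnegrE // ler_nat ltnS.
exact: leq_subr.
Qed.

(** As [q] depends on [tau] only, every iteration shrinks the excess of the exponent over [tau] by
    the same ratio. *)
Lemma gens_growth tau : 0 < tau -> exists k, growth_le (gens k) (2 * tau).
Proof.
move=> tau_gt0; have [q q_gt0 Hq] := growth_step tau_gt0.
pose rho : R := 1 - q%:R^-1.
have rho_ge0 : 0 <= rho by rewrite subr_ge0 invf_le1 ?ltr0n // ler1n.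
have rho_lt1 : rho < 1 by rewrite ltrBlDr ltrDl invr_gt0 ltr0n.
have gens_le k : growth_le (gens k) (tau + 2 * rho ^+ k).
  elim: k => [|k IH].
    (* There are 3^n words, and 3 = 1 + 2 <= e^2. *)
    exists 1 => // n; exists (map (prodw (gens 0)) (words n)) => [|w <-].
      rewrite size_map size_words mul1r natrX mulrC expRM_natl.
      rewrite lerXn2r ?nnegrE ?expR_ge0 //.
      by apply: le_trans (expR_ge1Dx _); rewrite expr0; lra.
    exact/map_f/mem_words.
  have rk : 0 <= rho ^+ k by exact: exprn_ge0.
  apply: (Hq _ _ _ (@gens_invol k) IH).
  - by lra.
  - by rewrite lerDl mulr_ge0 // exprn_ge0.
  - by rewrite -/rho exprS; nra.
have [k rho_k] : exists k, 2 * rho ^+ k <= tau.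
  have := @cvg_expr R rho; rewrite ger0_norm // => /(_ rho_lt1).
  move=> /cvgrPdist_le /(_ (tau / 2)) [|N _ /(_ N)]; first by rewrite divr_gt0.
  rewrite /= leqnn sub0r normrN ger0_norm ?exprn_ge0 // => /(_ isT) H.
  by exists N; lra.
exists k; have [C C_ge0 HC] := gens_le k; exists C => // n.
have [L Ls Lm] := HC n; exists L => //; apply: (le_trans Ls).
by rewrite ler_wpM2l // ler_expR ler_wpM2r //; lra.
Qed.

End GrowthBounds.

(** * Growth rates *)

Section GrowthRate.
Variable R : realType.

(** The limit is the infimum of the quotients: divide [n] by a nearly optimal [m]; the sum [B]
    bounds [u] at every remainder. *)
Lemma fekete (u : nat -> R) : (forall n, 0 <= u n) ->
    (forall m n, u (m + n)%N <= u m + u n) ->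
  cvgn (fun n => u n / n%:R).
Proof.
move=> u_ge0 u_add.
pose Q := [set u n / n%:R | n in [set n | (0 < n)%N]].
have lbQ : lbound Q 0 by move=> _ [n _ <-]; rewrite divr_ge0.
have infQ : has_inf Q by split; [exists (u 1%N / 1%:R); exists 1%N|exists 0].
apply/cvg_ex; exists (inf Q); apply/cvgrPdist_le => e e_gt0.
have e2 : 0 < e / 2 by rewrite divr_gt0.
have [_ [m /= m_gt0 <-] lt_m] := inf_adherent e2 infQ.
pose B := \sum_(i < m) u i.
have B_ge0 : 0 <= B by apply: sumr_ge0.
have u_mul q r : u (q * m + r)%N <= q%:R * u m + u r.
  elim: q => [|q IH]; first by rewrite mul0n add0n mul0r add0r.
  rewrite mulSn -addnA; apply: (le_trans (u_add _ _)).
  by rewrite -nat1r mulrDl mul1r -addrA lerD2l.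
have u_le n : u n <= n%:R * (u m / m%:R) + B.
  rewrite [in u n](divn_eq n m); apply: (le_trans (u_mul _ _)); apply: lerD.
    rewrite mulrCA [leLHS]mulrC ler_wpM2l // ler_pdivlMr ?ltr0n // -natrM ler_nat.
    exact: leq_divM.
  rewrite /B (bigD1 (Ordinal (ltn_pmod n m_gt0))) //= lerDl.
  exact: sumr_ge0.
exists (Num.truncn (B / (e / 2))).+1 => // n /= le_n.
have n_gt0 : (0 : R) < n%:R by rewrite ltr0n (leq_trans _ le_n).
have Bn : B / n%:R <= e / 2.
  rewrite ler_pdivrMr // mulrC -ler_pdivrMr //.
  apply/ltW/(lt_le_trans (truncnS_gt _)); by rewrite ler_nat.
have le_inf : inf Q <= u n / n%:R.
  by apply: ge_inf; [exists 0|exists n => //=; rewrite (leq_trans _ le_n)].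
rewrite distrC ger0_norm ?subr_ge0 // lerBlDr.
have : u n / n%:R <= u m / m%:R + B / n%:R.
  by rewrite ler_pdivrMr // mulrDl divfK ?gt_eqF // mulrC.
move: lt_m Bn; lra.
Qed.

Section Balls.
Variables (G : groupType) (S : set G).
Hypothesis finS : finite_set S.

Let c n : nat := #|` fset_set (word_ball S n)|.

Lemma mem_ball n g : (g \in fset_set (word_ball S n)) = (g \in word_ball S n).
Proof. exact/in_fset_set/finite_word_ball. Qed.

Lemma ball1 n : word_ball S n 1%g.
Proof. by exists [::]; split; rewrite ?big_nil. Qed.

Lemma card_ball_gt0 n : (0 < c n)%N.
Proof.
rewrite cardfs_gt0; apply/fset0Pn; exists 1%g; rewrite mem_ball.
exact/mem_set/ball1.
Qed.

Lemma card_ball_le n (L : seq G) :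
  (forall g, word_ball S n g -> g \in L) -> (c n <= size L)%N.
Proof.
move=> HL; apply: uniq_leq_size (fset_uniq _) _ => g.
by rewrite mem_ball => /set_mem/HL.
Qed.

Lemma card_ball_ge n (L : seq G) :
  uniq L -> (forall g, g \in L -> word_ball S n g) -> (size L <= c n)%N.
Proof.
move=> uL HL; apply: uniq_leq_size uL _ => g /HL gS.
by rewrite mem_ball; exact/mem_set.
Qed.

Lemma card_ballD m n : (c (m + n) <= c m * c n)%N.
Proof.
rewrite -(size_allpairs (fun g h => g * h)%g).
apply: card_ball_le => _ [w [szw Sw ->]].
rewrite -(cat_take_drop m w) big_cat; apply: allpairs_f; rewrite mem_ball.
  apply/mem_set; exists (take m w); split=> // [|s sw].
    by rewrite size_take_min geq_minl.
  by apply: Sw; exact: mem_take sw.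
apply/mem_set; exists (drop m w); split=> // [|s sw].
  by rewrite size_drop leq_subLR.
by apply: Sw; exact: mem_drop sw.
Qed.

Let u n : R := ln (c n)%:R.

Lemma growth_exponent_cvg : cvgn (fun n => u n / n%:R).
Proof.
apply: fekete => [n|m n]; first by rewrite ln_ge0 // ler1n card_ball_gt0.
rewrite /u -lnM ?posrE ?ltr0n ?card_ball_gt0 //.
rewrite -natrM ler_ln ?posrE ?ltr0n ?muln_gt0 ?card_ball_gt0 //.
by rewrite ler_nat card_ballD.
Qed.

Lemma growth_rateE : growth_rate R S = expR (limn (fun n => u n / n%:R)).
Proof.
apply: (cvg_lim (@Rhausdorff R)).
rewrite (_ : (fun n => _) = expR \o (fun n => u n / n%:R)).
  by apply: continuous_cvg; [exact: continuous_expR|exact: growth_exponent_cvg].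
apply/funext => n /=; rewrite /powR pnatr_eq0 -leqn0 leqNgt card_ball_gt0 /=.
by rewrite mulrC.
Qed.

Lemma growth_rate_le (a C : R) : 0 <= a ->
    (forall n, (c n)%:R <= C * expR (a * n%:R)) ->
  growth_rate R S <= expR a.
Proof.
move=> a_ge0 cC.
have C_gt0 : 0 < C.
  have := cC 0%N; rewrite mulr0 expR0 mulr1; apply: lt_le_trans.
  by rewrite ltr0n card_ball_gt0.
rewrite growth_rateE ler_expR; apply/ler_addgt0Pl => e e_gt0.
apply: limr_le; first exact: growth_exponent_cvg.
exists (Num.truncn (`|ln C| / e)).+1 => // n /= le_n.
have n_gt0 : (0 : R) < n%:R by rewrite ltr0n (leq_trans _ le_n).
rewrite ler_pdivrMr // mulrDl /u.
apply: (@le_trans _ _ (ln (C * expR (a * n%:R)))).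
  by rewrite ler_ln ?posrE ?mulr_gt0 ?expR_gt0 ?ltr0n ?card_ball_gt0.
rewrite lnM ?posrE ?expR_gt0 // expRK lerD2r.
apply: (le_trans (ler_norm _)); rewrite mulrC -ler_pdivrMr //.
by apply/ltW/(lt_le_trans (truncnS_gt _)); rewrite ler_nat.
Qed.

(** As the limit exists, lower bounds at arbitrarily large radii suffice. *)
Lemma growth_rate_ge (a : R) :
    (forall N, exists2 n, (N <= n)%N & expR (a * n%:R) <= (c n)%:R) ->
  expR a <= growth_rate R S.
Proof.
move=> Ha; rewrite growth_rateE ler_expR leNgt; apply/negP => lt_a.
have [N _ HN] := cvgr_lt _ growth_exponent_cvg _ lt_a.
have [n Nn le_c] := Ha N.+1.
have := HN n (ltnW Nn); rewrite /= ltr_pdivrMr ?ltr0n ?(leq_trans _ Nn) //.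
rewrite ltNge /u -[a * _]expRK ler_ln ?posrE ?expR_gt0 ?ltr0n ?card_ball_gt0 //.
by rewrite le_c.
Qed.

End Balls.

Lemma finite_gens k : finite_set (range (gens k)).
Proof.
rewrite (_ : range _ = [set gens k X; gens k Y; gens k Z]); first exact: finite_set3.
by apply/seteqP; split=> [_ [[] _ <-]|_ [[]|] ->] /=; auto; eexists.
Qed.

Lemma gens_growth_rate (tau : R) : 0 < tau ->
  exists k, growth_rate R (range (gens k)) <= expR tau.
Proof.
(* Two thirds go to the words of fixed length, one third absorbs the factor n + 1 for the lengths up
   to n. *)
move=> tau_gt0; pose d := tau / 3.
have d_gt0 : 0 < d by rewrite divr_gt0.
have [k [C C_ge0 HC]] := gens_growth d_gt0.
have [D D_ge0 HD] := poly_le_expR 1 d_gt0.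
have finS : finite_set (range (gens k)).
  exact: finite_gens.
exists k; apply: (@growth_rate_le _ _ finS _ (D * C)); first exact: ltW.
move=> n.
have [L Ls Lm] : exists2 L : seq (sym (seq plane)),
    (size L)%:R <= n.+1%:R * (C * expR (2 * d * n%:R)) &
    forall w, (size w <= n)%N -> prodw (gens k) w \in L.
  have le_a m : (m <= n)%N -> C * expR (2 * d * m%:R) <= C * expR (2 * d * n%:R).
    move=> mn; rewrite ler_wpM2l // ler_expR ler_wpM2l ?ler_nat //.
    by rewrite mulr_ge0 // ltW.
  move: le_a; set B := C * expR (2 * d * n%:R) => le_a.
  elim: (n) le_a => [|m IH] le_a.
    have [L Ls Lm] := HC 0%N; exists L => [|w].
      by rewrite mul1r; apply: (le_trans Ls); exact: le_a.
    by rewrite leqn0 => /eqP; exact: Lm.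
  have [|L Ls Lm] := IH; first by move=> i im; apply: le_a; exact: leqW.
  have [L' L's L'm] := HC m.+1; exists (L' ++ L) => [|w].
    rewrite size_cat natrD -(nat1r m.+1) mulrDl mul1r lerD //.
    by apply: (le_trans L's); exact: le_a.
  rewrite leq_eqVlt mem_cat => /orP[/eqP/L'm ->//|/Lm ->]; exact: orbT.
have cL : (#|` fset_set (word_ball (range (gens k)) n)| <= size L)%N.
  apply: card_ball_le => // _ [w [szw Sw ->]].
  (* The generators are involutions, so inverses in a word can be replaced by letters. *)
  suff [v sv ->] : exists2 v, size v = size w &
      (\prod_(s <- w) s = prodw (gens k) v)%g by apply: Lm; rewrite sv.
  elim: w Sw {szw} => [|s w IH] Sw; first by exists [::]; rewrite /prodw ?big_nil.
  have [|v sv Ev] := IH; first by move=> r rw; apply: Sw; rewrite inE rw orbT.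
  have [l sl] : exists l, s = gens k l.
    have [[l _ <-]|[l _ El]] := Sw s (mem_head _ _); exists l => //.
    apply: (mulIg (gens k l)); rewrite gens_invol [in LHS]El; exact: mulgV.
  by exists (l :: v) => /=; rewrite ?sv // /prodw !big_cons Ev sl.
apply: (@le_trans _ _ (size L)%:R); first by rewrite ler_nat.
apply: (le_trans Ls).
have -> : tau * n%:R = d * n%:R + 2 * d * n%:R by rewrite /d; field.
rewrite expRD.
rewrite (_ : D * C * _ = D * expR (d * n%:R) * (C * expR (2 * d * n%:R)));
  last by ring.
rewrite ler_wpM2r ?mulr_ge0 ?expR_ge0 //.
by have := HD n; rewrite expr1.
Qed.

Lemma W_not_uniform : ~ uniformly_exponential_growth R W.
Proof.
rewrite /uniformly_exponential_growth => i_gt1.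
set Q := (X in inf X) in i_gt1.
have lbQ : has_lbound Q.
  (* By convention [inf] is 0 for a set without infimum, which contradicts [i_gt1]. *)
  have [[]//|/inf_out E] := pselect (has_inf Q).
  by move: i_gt1; rewrite E ltr10.
have i_gt0 : 0 < inf Q by apply: lt_trans i_gt1.
(* Half the logarithm gives a generating set whose rate is at most the square root of the
   infimum. *)
have [k] := @gens_growth_rate (ln (inf Q) / 2) (divr_gt0 (ln_gt0 i_gt1) (ltr0n _ 2)).
apply/negP; rewrite -ltNge; apply: (@lt_le_trans _ _ (inf Q)).
  rewrite -[ltRHS]lnK ?posrE // ltr_expR ltr_pdivrMr // ltr_pMr ?ln_gt0 //.
  by rewrite ltr1n.
apply: ge_inf => //; exists (range (gens k)) => //; split; last exact: gens_generate.
exact: finite_gens.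
Qed.

End GrowthRate.

(** * Exponential growth *)

Local Open Scope group_scope.

(* Two distinct involutions of A that exchange the points 1 and 2. *)
Definition swap12 (b : bool) : {perm plane} :=
  permw (if b then [:: Y; X; Z; X; Y] else [:: Y; X; Z; X; Z; Y]).

Lemma swap12_pt1 b : swap12 b pt1 = pt2.
Proof. by apply: val_inj; rewrite /= permw_actw; case: b. Qed.

Lemma swap12_pt2 b : swap12 b pt2 = pt1.
Proof. by apply: val_inj; rewrite /= permw_actw; case: b. Qed.

Lemma swap12_invol b : swap12 b * swap12 b = 1.
Proof. by rewrite -permw_cat; apply: permw1P; case: b. Qed.

Lemma swap12_inj : injective swap12.
Proof.
have neq : swap12 true != swap12 false.
  apply/eqP => /(congr1 (fun s : {perm plane} => val (s pt4))) /=.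
  by rewrite !permw_actw.
by case=> -[] // E; case/eqP: neq; rewrite E.
Qed.

Definition swap_word (s : seq (bool * bool)) : sym (seq plane) :=
  \prod_(x <- s) (bar_sym (swap12 x.1) * head_sym (swap12 x.2)).

(** All factors are involutions, so inverting a reversed word only swaps the two factors in each
    pair; this is the shape of the section at 2. *)
Lemma swap_wordV s :
  (swap_word (rev s))^-1 =
    \prod_(x <- s) (head_sym (swap12 x.2) * bar_sym (swap12 x.1)).
Proof.
elim: s => [|x s IH]; first by rewrite /swap_word !big_nil invg1.
rewrite big_cons -IH rev_cons -cats1 /swap_word big_cat big_seq1 !invMg.
have hV b : (head_sym (swap12 b))^-1 = head_sym (swap12 b).
  apply: (mulgI (head_sym (swap12 b))).
  by rewrite mulgV -head_symM swap12_invol head_sym1.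
have bV b : (bar_sym (swap12 b))^-1 = bar_sym (swap12 b).
  apply: (mulgI (bar_sym (swap12 b))).
  by rewrite mulgV -bar_symM swap12_invol bar_sym1.
by rewrite hV bV.
Qed.

Definition unpair T (s : seq (T * T)) : seq T := flatten [seq [:: x.1; x.2] | x <- s].

Lemma size_unpair T (s : seq (T * T)) : size (unpair s) = (size s).*2.
Proof. by elim: s => //= x s ->. Qed.

Lemma unpair_surj T n (s : seq T) :
  size s = n.*2 -> exists2 t, size t = n & s = unpair t.
Proof.
elim: n s => [|n IH] [|x [|y s]] //= => [_|[/IH[t <- ->]]].
  by exists [::].
by exists ((x, y) :: t).
Qed.

Lemma map_unpair T U (f : T -> U) (s : seq (T * T)) :
  map f (unpair s) = unpair (zip (map (f \o fst) s) (map (f \o snd) s)).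
Proof. by elim: s => //= x s ->. Qed.

(** A path from 1 or 2 is at the other of the two points after one factor and back after two, so it
    meets one barred and one plain label in each block. *)
Lemma swap_word_unpair (t : seq ((bool * bool) * (bool * bool))) :
  exists f s, [/\ swap_word (unpair t) = dec f s,
    f pt1 = swap_word [seq (x.1.1, x.2.1) | x <- t] &
    f pt2 = (swap_word (rev [seq (x.2.1, x.1.1) | x <- t]))^-1].
Proof.
elim: t => [|[[a b] [d e]] t [f [s [E f1 f2]]]].
  by exists (fun=> 1), 1; rewrite /swap_word !big_nil dec1 // invg1.
rewrite /= swap_wordV in f2; rewrite swap_wordV /=.
rewrite /swap_word !big_cons -/(swap_word _) E /=.
rewrite (bar_symE (swap12 a)) (bar_symE (swap12 d)).
rewrite (head_symE (swap12 b)) (head_symE (swap12 e)).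
rewrite !decM; do 2 eexists; split; first by [].
  rewrite /= ?(perm1, permM, mul1g, mulg1, swap12_pt1, swap12_pt2) /=.
  by rewrite -bar_symE f1 !mulgA.
rewrite /= ?(perm1, permM, mul1g, mulg1, swap12_pt1, swap12_pt2) /=.
by rewrite -bar_symE f2 !mulgA.
Qed.

Lemma swap_word_inj k s s' : size s = (2 ^ k)%N -> size s' = (2 ^ k)%N ->
  swap_word s = swap_word s' -> map fst s = map fst s'.
Proof.
elim: k s s' => [|k IH] s s'.
  case: s => [|[a b] []] //; case: s' => [|[a' b'] []] // _ _.
  rewrite /swap_word !big_seq1 /= !(head_symE (swap12 b)) !(head_symE (swap12 b')).
  rewrite (bar_symE (swap12 a)) (bar_symE (swap12 a')) !decM => /dec_eq[+ _].
  (* The section at 2 of a single factor is the plain copy of its barred involution. *)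
  move=> /(_ pt2) /=; rewrite !mulg1 !head_symE => /dec_eq[_ /swap12_inj ->] //.
rewrite expnS mul2n => /unpair_surj[t szt ->] /unpair_surj[t' szt' ->].
have [f [p [-> f1 f2]]] := swap_word_unpair t.
have [f' [p' [-> f1' f2']]] := swap_word_unpair t'.
case/dec_eq => ff' _; have := ff' pt1; rewrite f1 f1' => /IH.
rewrite !size_map => /(_ szt szt') E1.
have := ff' pt2; rewrite f2 f2' => /invg_inj/IH.
rewrite !size_rev !size_map => /(_ szt szt').
rewrite !map_rev => /(can_inj revK) E2.
rewrite !map_unpair; congr (unpair (zip _ _)).
  by move: E1; rewrite -!map_comp.
by move: E2; rewrite -!map_comp.
Qed.

Local Close Scope group_scope.

Definition W_gens : set (sym (seq plane)) :=
  [set head_sym a | a in [set` A]] `|` [set bar_sym a | a in [set` A]].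

Lemma finite_W_gens : finite_set W_gens.
Proof. by rewrite finite_setU; split; exact/finite_image/finite_finset. Qed.

Lemma W_exponential (R : realType) : exponential_growth R W.
Proof.
have finS := finite_W_gens.
(* The rate is at least the square root of 2: for m a power of 2, there are 2^m distinct products in
   the ball of radius 2 m. *)
exists W_gens; split=> //; apply: (@lt_le_trans _ _ (expR (ln 2 / 2))).
  by rewrite -[ltLHS]expR0 ltr_expR divr_gt0 ?ln_gt0 ?ltr1n.
apply: (growth_rate_ge finS) => N; exists ((2 ^ N).*2)%N.
  by rewrite -addnn; apply: leq_trans (ltnW (ltn_expl N _)) (leq_addr _ _).
pose L := [seq swap_word [seq (b, true) | b <- tval bs] | bs : (2 ^ N).-tuple bool].
have -> : expR (ln 2 / 2 * (2 ^ N).*2%:R) = (size L)%:R :> R.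
  rewrite size_map -cardE card_tuple card_bool natrX -muln2 natrM.
  rewrite (_ : _ * _ = (2 ^ N)%:R * ln 2) ?expRM_natl ?lnK ?posrE //.
  by rewrite mulrC; field.
rewrite ler_nat; apply: card_ball_ge => // [|_ /mapP[bs _ ->]].
  rewrite map_inj_uniq ?enum_uniq // => bs bs' /swap_word_inj E.
  apply: val_inj; have := E N; rewrite !size_map !size_tuple => /(_ erefl erefl).
  by rewrite -!map_comp !map_id.
exists (unpair [seq (bar_sym (swap12 b), head_sym (swap12 true)) | b <- tval bs]).
split; first by rewrite size_unpair size_map size_tuple.
  move=> s /flattenP[_ /mapP[_ /mapP[b _ ->] ->]]; rewrite !inE 
    => /orP[] /eqP -> /=; left.
    by right; exists (swap12 b) => //=; exact: permw_in_A.
  by left; exists (swap12 true) => //=; exact: permw_in_A.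
rewrite /swap_word; elim: (tval bs) => [|b s IH] /=; first by rewrite !big_nil.
by rewrite !big_cons -IH mulgA.
Qed.

Theorem theorem2p1 (R : realType) :
  exponential_growth R W /\ ~ uniformly_exponential_growth R W.
Proof. by split; [exact: W_exponential|exact: W_not_uniform]. Qed.
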